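(* Let $M$ be a full affine semigroup and let $A$ be a subset of $M$. Then $$\operatorname{Ap}(M,A)=\{y\in M\mid \lambda_M(x,y)<1\text{ for all }x\in A\}.$$
   Context: $\mathbb N$ denotes the nonnegative integers. An affine semigroup is a finitely generated submonoid $M$ of $(\mathbb N^n,+)$ for some positive $n$. With $\operatorname{G}(M)=\{a-b\mid a,b\in M\}\subseteq\mathbb Z^n$, $M$ is full if $\operatorname{G}(M)\cap\mathbb N^n=M$. For $a,b\in M$, $a\le_M b$ means $b-a\in M$. $\operatorname{Ap}(M,A)=M\setminus(A+M)$. The extraction grade of $x,y\in M$ is $\lambda_M(x,y)=\sup\{m/n\mid mx\le_M ny,\ m,n\in\mathbb N,\ n\neq0\}\in\mathbb R_+\cup\{\infty\}$. *)

(* Defs.v *)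
From mathcomp Require Import all_boot all_order all_algebra.
From mathcomp Require Import all_classical all_reals ereal.

Set Implicit Arguments.
Unset Strict Implicit.
Unset Printing Implicit Defensive.

Import Order.TTheory GRing.Theory Num.Theory.
Local Open Scope classical_set_scope.
Local Open Scope ring_scope.

(* N^n, viewed inside Z^n so that differences of its elements make sense. *)
Definition orthant (n : nat) : set 'rV[int]_n :=
  [set v : 'rV[int]_n | forall i, 0 <= v 0 i].
Arguments orthant : clear implicits.

Definition submonoid (n : nat) (M : set 'rV[int]_n) : Prop :=
  M 0 /\ forall a b, M a -> M b -> M (a + b).

Definition affine_semigroup (n : nat) (M : set 'rV[int]_n) : Prop :=
  [/\ M `<=` orthant n,
      submonoid M
    & exists2 S, finite_set S & M = smallest (@submonoid n) S].

Definition group_of (n : nat) (M : set 'rV[int]_n) : set 'rV[int]_n :=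
  [set a - b | a in M & b in M].

Definition full (n : nat) (M : set 'rV[int]_n) : Prop :=
  group_of M `&` orthant n = M.

Definition leM (n : nat) (M : set 'rV[int]_n) (a b : 'rV[int]_n) : Prop :=
  M (b - a).

Definition Ap (n : nat) (M A : set 'rV[int]_n) : set 'rV[int]_n :=
  M `\` [set a + m | a in A & m in M].

(* The set of ratios always contains 0 when [M] is a monoid and [y] is in [M],
   so the supremum in [\bar R] then lies in [0, +oo]. *)
Definition extraction_grade (R : realType) (n : nat) (M : set 'rV[int]_n)
    (x y : 'rV[int]_n) : \bar R :=
  ereal_sup [set r : \bar R | exists m k : nat,
    [/\ k != 0%N, leM M (x *+ m) (y *+ k) & r = (m%:R / k%:R)%:E]].

(* Main.v *)
Require Import Defs.
From mathcomp Require Import all_boot all_order all_algebra.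
From mathcomp Require Import all_classical all_reals ereal.

Set Implicit Arguments.
Unset Strict Implicit.
Unset Printing Implicit Defensive.

Import Order.TTheory GRing.Theory Num.Theory.
Local Open Scope classical_set_scope.
Local Open Scope ring_scope.

(** An element [y] of [M] lies in the Apery set of [A] exactly when [y - x] is
    outside [M] for every [x] in [A], so it is enough to show that, for [x] and
    [y] in [M], the extraction grade is less than 1 iff [y - x] is outside [M]
    ([extraction_grade_lt1]).  If [y - x] is in [M], the ratio 1/1 is one of
    those in the supremum.  Otherwise fullness forces [y - x] out of the
    orthant, since [y - x] is a difference of elements of [M]; hence
    [y_i < x_i] for some coordinate [i].  Reading [m x <= k y] at that
    coordinate gives [m / k <= y_i / x_i], so the whole supremum is at most
    [y_i / x_i], which is less than 1 ([extraction_grade_le_ratio]). *)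

(** [y - x] lies in the group of [M] by construction, so fullness leaves only
    the orthant condition to check. *)
Lemma leM_full (n : nat) (M : set 'rV[int]_n) (x y : 'rV[int]_n) :
  full M -> M x -> M y -> leM M x y <-> forall i, x 0 i <= y 0 i.
Proof.
move=> fullM Mx My; rewrite /leM -fullM; split=> [[_ yx] i|xy].
  by have := yx i; rewrite !mxE subr_ge0.
split=> [|i]; last by rewrite !mxE subr_ge0.
by exists y => //; exists x.
Qed.

(** Taking the supremum to a bound, rather than only bounding each ratio by 1,
    is what later keeps the inequality strict. *)
Lemma extraction_grade_le_ratio (R : realType) (n : nat)
    (M : set 'rV[int]_n) (x y : 'rV[int]_n) (i : 'I_n) :
  M `<=` orthant n -> 0 < x 0 i ->
  (extraction_grade R M x y <= ((y 0 i)%:~R / (x 0 i)%:~R)%:E)%E.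
Proof.
move=> Mpos xi_gt0; apply: ge_ereal_sup => _ [m [k [k_neq0 /Mpos kymx ->]]].
have := kymx i; rewrite mxE mxE !mulmxnE subr_ge0 => mxky.
rewrite lee_fin ler_pdivrMr ?ltr0n ?lt0n // mulrAC ler_pdivlMr ?ltr0z //.
by rewrite mulr_natl mulr_natr -!rmorphMn ler_int.
Qed.

(** Fullness is essential here: in the submonoid of [N] generated by 2 and 3,
    the difference 3 - 2 is missing, yet [3 * 2 <= 2 * 3] gives the pair (2, 3)
    the extraction grade 3/2. *)
Lemma extraction_grade_lt1 (R : realType) (n : nat) (M : set 'rV[int]_n)
    (x y : 'rV[int]_n) :
  M `<=` orthant n -> full M -> M x -> M y ->
  (extraction_grade R M x y < 1)%E <-> ~ leM M x y.
Proof.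
move=> Mpos fullM Mx My; split=> [lt1 xy|].
  have : (1 <= extraction_grade R M x y)%E.
    by apply: ereal_sup_ubound; exists 1%N, 1%N; rewrite !mulr1n divr1.
  by rewrite leNgt lt1.
rewrite leM_full// => /existsNP[i /negP]; rewrite -ltNge => yx.
have xi_gt0 : 0 < x 0 i by apply: le_lt_trans yx; exact: Mpos.
apply: le_lt_trans (extraction_grade_le_ratio R y Mpos xi_gt0) _.
by rewrite lte_fin ltr_pdivrMr ?ltr0z // mul1r ltr_int.
Qed.

Lemma in_Ap (n : nat) (M A : set 'rV[int]_n) (y : 'rV[int]_n) :
  Ap M A y <-> M y /\ forall x, A x -> ~ leM M x y.
Proof.
split=> -[My yA]; split=> //.
  by move=> x Ax xy; apply: yA; exists x => //; exists (y - x) => //; exact: subrKC.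
by move=> [x Ax [m Mm xmy]]; apply: (yA x Ax); rewrite /leM -xmy addrC addKr.
Qed.

Theorem proposition18 (R : realType) (n : nat) (M A : set 'rV[int]_n)
  (n_gt0 : (0 < n)%N) (affM : affine_semigroup M) (fullM : full M)
  (AM : A `<=` M) :
  Ap M A =
  [set y | M y /\ forall x, A x -> (extraction_grade R M x y < 1)%E].
Proof.
have [Mpos _ _] := affM.
apply/seteqP; split=> y /=.
  move=> /in_Ap[My yA]; split=> // x Ax.
  by apply/extraction_grade_lt1 => //; [exact: AM|exact: yA].
move=> [My yA]; apply/in_Ap; split=> // x Ax.
by apply/(extraction_grade_lt1 R) => //; [exact: AM|exact: yA].
Qed.
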